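(* For any empirical risk minimization (ERM) algorithm $\mathcal A$ over a hypothesis class $\mathcal H$ with $|\mathcal H|\ge2$, for classification with 0--1 loss, and for every number of folds $k\ge2$ with $k\mid n$, $$\max_{\mathcal D}\mathrm{MSE}^{(k)}_{\mathrm{CV}}(\mathcal A,\mathcal D)=\Omega\!\left(\frac{\sqrt k}{n}\right),$$ i.e. there is a constant $c>0$ such that for all sufficiently large $n$ and every $k\ge2$ with $k\mid n$ one has $\max_{\mathcal D}\mathrm{MSE}^{(k)}_{\mathrm{CV}}(\mathcal A,\mathcal D)\ge c\sqrt k/n$.
   Context: Let $\mathcal X$ be the input space, $\mathcal Y$ a (binary or multiclass) label set, and $\mathcal H\subseteq\mathcal Y^{\mathcal X}$ a hypothesis class. A (possibly randomized) learning rule $\mathcal A$ maps finite samples from $\mathcal X\times\mathcal Y$ to elements of $\mathcal H$ and is permutation-invariant. $\mathcal A$ is an ERM algorithm over $\mathcal H$ if on every sample $S$ it outputs an $h\in\mathcal H$ minimizing the empirical 0--1 error $\frac1{|S|}\sum_{(x,y)\in S}\mathbf 1\{h(x)\ne y\}$ (ties broken arbitrarily). For a distribution $\mathcal D$ on $\mathcal X\times\mathcal Y$, an i.i.d. sample $S^n\sim\mathcal D^n$, and $k\ge2$ with $k\mid n$, partition $S^n$ into $k$ disjoint folds $S_1,\dots,S_k$ of size $m=n/k$, put $S_{-i}=S^n\setminus S_i$, $\widehat L_i=\frac1m\sum_{(x,y)\in S_i}\mathbf 1\{\mathcal A(S_{-i})(x)\ne y\}$, $\widehat L_{\mathrm{CV}}^{(k)}=\frac1k\sum_{i=1}^k\widehat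 L_i$, and $$\mathrm{MSE}^{(k)}_{\mathrm{CV}}(\mathcal A,\mathcal D)=\mathbb E_{S^n\sim\mathcal D^n,\mathcal A}\big[(\widehat L_{\mathrm{CV}}^{(k)}-L(\mathcal A(S^n)))^2\big],\qquad L(h)=\mathbb P_{(x,y)\sim\mathcal D}[h(x)\ne y].$$ The maximum over $\mathcal D$ (understood as a supremum) is over all distributions on $\mathcal X\times\mathcal Y$. *)

(* Defs.v *)
From HB Require Import structures.
From mathcomp Require Import all_boot all_order all_algebra perm.
From mathcomp Require Import all_classical all_reals all_analysis.
From mathcomp Require Import measurable_realfun.

Set Implicit Arguments.
Unset Strict Implicit.
Unset Printing Implicit Defensive.
Import Order.TTheory GRing.Theory Num.Theory.
Import numFieldNormedType.Exports.

Local Open Scope classical_set_scope.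
Local Open Scope ring_scope.

Section product_probability.
Context d1 d2 (T1 : measurableType d1) (T2 : measurableType d2) (R : realType).
Variables (P : probability T1 R) (Q : probability T2 R).

Definition prod_measure : set (T1 * T2) -> \bar R := (P \x Q)%E.

HB.instance Definition _ := Measure.on prod_measure.

Let prod_measureT : prod_measure [set: T1 * T2] = 1%E.
Proof.
rewrite /prod_measure -setXTT product_measure1E//.
by rewrite -[RHS]mule1; congr (_ * _)%E; exact: probability_setT.
Qed.

HB.instance Definition _ := Measure_isProbability.Build _ _ _
  prod_measure prod_measureT.

Definition prod_prob : probability (T1 * T2)%type R := prod_measure.

End product_probability.

Section tuple_product.
Context d (T : measurableType d) (R : realType).

Definition tcons n (z : T * n.-tuple T) : n.+1.-tuple T :=
  [tuple of z.1 :: z.2].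

Lemma measurable_tcons n : measurable_fun [set: T * n.-tuple T] (@tcons n).
Proof. exact: measurable_cons measurable_fst measurable_snd. Qed.

HB.instance Definition _ n :=
  isMeasurableFun.Build _ _ _ _ (@tcons n) (@measurable_tcons n).

Definition cons_prob n (P : probability T R) (Q : probability (n.-tuple T) R) :
    probability (n.+1.-tuple T) R :=
  distribution (prod_prob P Q) (@tcons n).

(* The product measure of mu 0, ..., mu (n - 1); tuple_probE gives its values
   on boxes. *)
Fixpoint tuple_prob n : ('I_n -> probability T R) -> probability (n.-tuple T) R :=
  match n with
  | 0 => fun=> \d_ ([tuple] : 0.-tuple T)
  | n'.+1 => fun mu =>
      cons_prob (mu ord0) (tuple_prob (fun i => mu (lift ord0 i)))
  end.

Lemma measurable_box n (B : 'I_n -> set T) :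
  (forall i, measurable (B i)) ->
  measurable [set t : n.-tuple T | forall i, B i (tnth t i)].
Proof.
move=> mB; rewrite [X in measurable X](_ : _ =
    \big[setI/setT]_(i <- index_enum 'I_n)
      ((fun t : n.-tuple T => tnth t i) @^-1` B i)).
  apply: bigsetI_measurable => i _; rewrite -[X in measurable X]setTI.
  exact: measurable_tnth.
rewrite -bigcap_seq; apply/seteqP; split=> t /= h i; first by move=> _; exact: h.
by apply: h; rewrite /= mem_index_enum.
Qed.

Lemma tuple_probE n (mu : 'I_n -> probability T R) (B : 'I_n -> set T) :
  (forall i, measurable (B i)) ->
  tuple_prob mu [set t : n.-tuple T | forall i, B i (tnth t i)] =
  (\prod_(i < n) mu i (B i))%E.
Proof.
elim: n mu B => [|n IH] mu B mB /=.
  by rewrite big_ord0 diracE mem_set// => -[].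
rewrite big_ord_recl -IH// /distribution /pushforward /= /prod_measure.
rewrite -product_measure1E//; last first.
  by apply: (@measurable_box _ (fun i => B (lift ord0 i))) => i; exact: mB.
congr (_ _); apply/seteqP; split=> -[x t] /=.
  move=> h; split; first by have := h ord0; rewrite tnth0.
  by move=> i; have := h (lift ord0 i); rewrite tnthS.
move=> [h0 h] i; case: (unliftP ord0 i) => [j ->|->]; last by rewrite tnth0.
by rewrite tnthS.
Qed.

End tuple_product.

Section cross_validation.
Context {R : realType} {dX dY dH : measure_display}.
Context {X : measurableType dX} {Y : measurableType dY}.

(* H is the hypothesis class, as a type, and ev h : X -> Y is the function
   underlying h (ev is meant to be injective); H carries a sigma-algebra so that
   a randomized learning rule can be given by the law of its output. *)
Context {H : measurableType dH}.
Variable ev : H -> X -> Y.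

Definition error_set (h : H) : set (X * Y) := [set z | ev h z.1 != z.2].

(* Measurability of (h, (x, y)) |-> 1{h(x) <> y}: it gives a meaning to L(h), and
   to its expectation when h is random. When H and Y are countable with their
   discrete sigma-algebras, it says that every h is measurable. *)
Definition measurable_error : Prop :=
  measurable [set p : H * (X * Y) | error_set p.1 p.2].

Definition loss01 (h : H) (z : X * Y) : R := (ev h z.1 != z.2)%:R.

Definition risk (D : probability (X * Y)%type R) (h : H) : R :=
  fine (D (error_set h)).

Definition empirical_error n (S : n.-tuple (X * Y)) (h : H) : R :=
  n%:R^-1 * \sum_(j < n) loss01 h (tnth S j).

(* A randomized learning rule: A n S is the law of the hypothesis output on the
   sample S of size n; a deterministic rule outputs Dirac measures. *)
Variable A : forall n, n.-tuple (X * Y) -> probability H R.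

Definition measurable_rule : Prop :=
  forall n (U : set H), measurable U ->
    measurable_fun [set: n.-tuple (X * Y)] (fun S => A S U).

(* Equality of the laws, hence only on measurable sets. *)
Definition permutation_invariant : Prop :=
  forall n (S : n.-tuple (X * Y)) (s : 'S_n) (U : set H), measurable U ->
    A [tuple tnth S (s i) | i < n] U = A S U.

Definition is_ERM : Prop :=
  forall n (S : n.-tuple (X * Y)),
    {ae A S, forall h, forall h', empirical_error S h <= empirical_error S h'}.

Section folds.
Variables (n k : nat) (fold : 'I_n -> 'I_k).

Definition fold_set (i : 'I_k) : {set 'I_n} := [set j | fold j == i]%SET.

Definition balanced : Prop := forall i, #|fold_set i| = (n %/ k)%N.

Definition training_sample (S : n.-tuple (X * Y)) (i : 'I_k) :
    #|~: fold_set i|.-tuple (X * Y) :=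
  [tuple tnth S (enum_val j) | j < #|~: fold_set i|].

Definition fold_error (S : n.-tuple (X * Y)) (i : 'I_k) (h : H) : R :=
  (n %/ k)%:R^-1 * \sum_(j in fold_set i) loss01 h (tnth S j).

(* hs is the tuple of the hypotheses trained on the complements of the folds. *)
Definition cv_estimate (S : n.-tuple (X * Y)) (hs : k.-tuple H) : R :=
  k%:R^-1 * \sum_(i < k) fold_error S i (tnth hs i).

(* The k + 1 runs of the rule, on the k training samples and on S, use
   independent internal randomness given S. *)
Definition cv_mse (D : probability (X * Y)%type R) : \bar R :=
  (\int[tuple_prob (fun _ : 'I_n => D)]_S
    \int[tuple_prob (fun i : 'I_k => A (training_sample S i))]_hs
      \int[A S]_h ((cv_estimate S hs - risk D h) ^+ 2)%:E)%E.

End folds.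

End cross_validation.

(* Main.v *)
Require Import Defs.
From HB Require Import structures.
From mathcomp Require Import all_boot all_order all_algebra.
From mathcomp Require Import all_classical all_reals all_analysis.
From mathcomp Require Import perm measurable_realfun ring lra zify.

(** Two hypotheses disagree at some point [x0].  The hard distribution tosses a
    fair coin to label [x0] by one value or the other.  Write the labels as signs,
    let [T] be their sum over the sample and [T_i] their sum over the [i]-th fold,
    of size [m = n / k].  An empirical risk minimizer outputs the majority label
    of its training sample, and both labels have risk 1/2.  Given the sample, the
    cross-validation estimate minus the risk therefore has mean
    [- (1 / (2 n)) * sum_i T_i * vote (T - T_i)] ([mean_gap_correlation]), where
    [vote] is the sign with some mean value at a tie.  By Jensen's inequality the
    mean squared error is at least the mean square of that quantity
    ([cv_mse_coin_ge]), which lives on the cube of coin tosses.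

    The point is that the errors made on different folds are positively
    correlated.  For folds [i <> j] put [W = T - T_i - T_j].  The product
    [T_i * vote (W + T_j) * (T_j * vote (W + T_i))] regroups into two factors that
    are independent and identically distributed given [W], so its mean is the mean
    of the square of [drift W], with [drift w = E (T_i * vote (w + T_i))].  Here
    [W] is a simple random walk of [n - 2 m] steps and [T_i] one of [m] steps.
    As long as [|w|] is at most of order [sqrt m], the sign of [w + T_i] is mostly
    that of [T_i] and the drift has order [sqrt m] ([drift_pair_ge],
    [mean_abs_ge]); a walk of at most [k * m] steps is that close to the origin
    with probability of order at least [1 / sqrt k] ([walk_concentrated]).  Each of
    the [k * (k - 1)] cross terms is thus of order at least [m / sqrt k]
    ([drift_sqr_ge]), and dividing their sum by [4 n ^ 2] leaves [sqrt k / n]. *)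

Set Implicit Arguments.
Unset Strict Implicit.
Unset Printing Implicit Defensive.
Import Order.TTheory GRing.Theory Num.Theory.

Local Open Scope classical_set_scope.
Local Open Scope ring_scope.

(** * Fair coins and simple random walks *)

Section coin_mean.
Variable R : realType.

(** The expectation over independent fair coin tosses.  Conditioning on the first
    toss matches the recursive construction of the product measure. *)
Fixpoint coin_mean n : (n.-tuple bool -> R) -> R :=
  match n with
  | 0 => fun F => F [tuple]
  | n'.+1 => fun F => (coin_mean (fun b => F [tuple of true :: b]) +
                       coin_mean (fun b => F [tuple of false :: b])) / 2
  end.

Lemma eq_coin_mean n (F G : n.-tuple bool -> R) :
  F =1 G -> coin_mean F = coin_mean G.
Proof. by move=> /funext ->. Qed.

Lemma coin_meanD n (F G : n.-tuple bool -> R) :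
  coin_mean (fun b => F b + G b) = coin_mean F + coin_mean G.
Proof. by elim: n F G => //= n IH F G; rewrite !IH; ring. Qed.

Lemma coin_meanZ n c (F : n.-tuple bool -> R) :
  coin_mean (fun b => c * F b) = c * coin_mean F.
Proof. by elim: n F => //= n IH F; rewrite !IH; ring. Qed.

Lemma coin_mean_cst n c : coin_mean (fun _ : n.-tuple bool => c) = c.
Proof. by elim: n => //= n ->; field. Qed.

Lemma coin_mean_sum n (I : finType) (P : pred I) (F : I -> n.-tuple bool -> R) :
  coin_mean (fun b => \sum_(i | P i) F i b) = \sum_(i | P i) coin_mean (F i).
Proof.
elim: n F => //= n IH F.
by rewrite !IH -big_split/= mulr_suml.
Qed.

Lemma le_coin_mean n (F G : n.-tuple bool -> R) :
  (forall b, F b <= G b) -> coin_mean F <= coin_mean G.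
Proof.
elim: n F G => //= n IH F G FG.
by rewrite ler_pM2r ?invr_gt0// lerD// IH.
Qed.

Definition sgnb (c : bool) : int := if c then 1 else -1.

Definition walk_mean n (phi : int -> R) : R :=
  coin_mean (fun b : n.-tuple bool => phi (\sum_j sgnb (tnth b j))).

Lemma sum_sgnb_cons n c (b : n.-tuple bool) (P : pred 'I_n.+1) :
  \sum_(j | P j) sgnb (tnth [tuple of c :: b] j) =
  (if P ord0 then sgnb c else 0) +
  \sum_(j | P (lift ord0 j)) sgnb (tnth b j).
Proof.
rewrite big_mkcond big_ord_recl tnth0; congr (_ + _).
by rewrite -big_mkcond; apply: eq_bigr => j _; rewrite tnthS.
Qed.

Lemma walk_mean0 phi : walk_mean 0 phi = phi 0.
Proof. by rewrite /walk_mean /= big_ord0. Qed.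

Lemma walk_meanS n phi : walk_mean n.+1 phi =
  (walk_mean n (fun t => phi (1 + t)) + walk_mean n (fun t => phi (-1 + t))) / 2.
Proof.
by congr ((_ + _) / 2); apply: eq_coin_mean => b; rewrite sum_sgnb_cons.
Qed.

Lemma walk_meanD n f g :
  walk_mean n (fun t => f t + g t) = walk_mean n f + walk_mean n g.
Proof. exact: coin_meanD. Qed.

Lemma walk_meanZ n c f : walk_mean n (fun t => c * f t) = c * walk_mean n f.
Proof. exact: coin_meanZ. Qed.

Lemma walk_mean_cst n c : walk_mean n (fun=> c) = c.
Proof. exact: coin_mean_cst. Qed.

Lemma le_walk_mean n f g : (forall t, f t <= g t) -> walk_mean n f <= walk_mean n g.
Proof. by move=> fg; apply: le_coin_mean => b; apply: fg. Qed.

(** Sums over disjoint blocks of coordinates are independent walks: each toss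
    moves exactly one of the three sums. *)
Lemma coin_mean_blocks n (P Q : pred 'I_n) (Phi : int -> int -> int -> R) :
  (forall j, ~~ (P j && Q j)) ->
  coin_mean (fun b : n.-tuple bool =>
    Phi (\sum_(j | P j) sgnb (tnth b j)) (\sum_(j | Q j) sgnb (tnth b j))
        (\sum_(j | ~~ P j && ~~ Q j) sgnb (tnth b j))) =
  walk_mean #|P| (fun p => walk_mean #|Q| (fun q =>
    walk_mean #|[pred j | ~~ P j && ~~ Q j]| (fun r => Phi p q r))).
Proof.
have cardS m (S : pred 'I_m.+1) :
    #|S| = (S ord0 + #|[pred j | S (lift ord0 j)]|)%N.
  rewrite -!sum1_card [LHS]big_mkcond big_ord_recl -big_mkcond.
  by congr (_ + _)%N; rewrite unfold_in; case: (S ord0).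
elim: n P Q Phi => [|n IH] P Q Phi PQ.
  have c0 (S : pred 'I_0) : #|S| = 0%N by apply: eq_card0 => -[].
  by rewrite /= !c0 !walk_mean0 !big_ord0.
rewrite /=; under eq_coin_mean do rewrite !sum_sgnb_cons.
under [X in _ + X]eq_coin_mean do rewrite !sum_sgnb_cons.
pose P' := [pred j | P (lift ord0 j)]; pose Q' := [pred j | Q (lift ord0 j)].
have PQ' j : ~~ (P' j && Q' j) by exact: PQ.
have IH' x y z := IH P' Q' (fun p q r => Phi (x + p) (y + q) (z + r)) PQ'.
rewrite !IH' !(cardS n) /=.
have := PQ ord0; case: (P ord0); case: (Q ord0) => //= _; rewrite ?add0n ?add1n.
- rewrite walk_meanS; congr ((_ + _) / 2);
  by congr walk_mean; apply/funext => p; congr walk_mean; apply/funext => q;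
    congr walk_mean; apply/funext => r; rewrite !add0r.
- rewrite -walk_meanD mulrC -walk_meanZ; congr walk_mean; apply/funext => p.
  rewrite walk_meanS mulrC; congr ((_ + _) / 2);
  by congr walk_mean; apply/funext => q;
    congr walk_mean; apply/funext => r; rewrite !add0r.
- rewrite -walk_meanD mulrC -walk_meanZ; congr walk_mean; apply/funext => p.
  rewrite -walk_meanD -walk_meanZ; congr walk_mean; apply/funext => q.
  rewrite walk_meanS mulrC; congr ((_ + _) / 2);
  by congr walk_mean; apply/funext => r; rewrite !add0r.
Qed.

Lemma walk_meanN n phi : walk_mean n (fun t => phi (- t)) = walk_mean n phi.
Proof.
elim: n phi => [|n IH] phi; first by rewrite !walk_mean0 oppr0.
rewrite !walk_meanS addrC.
rewrite -(IH (fun t => phi (1 + t))) -(IH (fun t => phi (-1 + t))).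
by congr ((walk_mean _ _ + walk_mean _ _) / 2); apply/funext => t;
  rewrite opprD ?opprK.
Qed.

Lemma walk_mean_add m n phi : walk_mean (m + n) phi =
  walk_mean m (fun u => walk_mean n (fun v => phi (u + v))).
Proof.
elim: m phi => [|m IH] phi.
  by rewrite walk_mean0; congr walk_mean; apply/funext => t; rewrite add0r.
rewrite addSn !walk_meanS !IH; congr ((walk_mean _ _ + walk_mean _ _) / 2);
by apply/funext => u; congr walk_mean; apply/funext => v; rewrite addrA.
Qed.

Lemma walk_mean2 n : walk_mean n (fun t => t%:~R ^+ 2) = n%:R.
Proof.
elim: n => [|n IH]; first by rewrite walk_mean0 expr0n.
rewrite walk_meanS -walk_meanD mulrC -walk_meanZ.
rewrite -[in RHS]addn1 natrD -{}IH -[1%:R](walk_mean_cst n) -walk_meanD.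
by congr walk_mean; apply/funext => t; rewrite !intrD; field.
Qed.

Lemma walk_mean4 n : walk_mean n (fun t => t%:~R ^+ 4) = 3 * n%:R ^+ 2 - 2 * n%:R.
Proof.
elim: n => [|n IH]; first by rewrite walk_mean0; ring.
rewrite walk_meanS -walk_meanD mulrC -walk_meanZ.
transitivity (walk_mean n (fun t => (t%:~R ^+ 4 : R) + (6 * t%:~R ^+ 2 + 1))).
  by congr walk_mean; apply/funext => t; rewrite !intrD; field.
rewrite !walk_meanD IH walk_meanZ walk_mean2 walk_mean_cst -[in RHS]addn1 natrD.
by ring.
Qed.

End coin_mean.

(** * Drift and concentration of the walk *)

Section walk_estimates.
Variable R : realType.
Local Notation walk_mean := (@walk_mean R).

Definition mean_abs m : R := walk_mean m (fun t => `|t|%:~R).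

(** The fourth moment method.  The polynomial bound on [|t|] is an equality at
    [|t| = a], and [a ^ 2 = 3 m] optimizes it for a walk of second moment [m] and
    fourth moment at most [3 m ^ 2]. *)
Lemma mean_abs_ge m : m%:R <= 3 * mean_abs m ^+ 2.
Proof.
have [->|m0] := posnP m; first by rewrite mulr_ge0// sqr_ge0.
have m0' : 0 < m%:R :> R by rewrite ltr0n.
pose a : R := Num.sqrt (3 * m%:R).
have a2 : a ^+ 2 = 3 * m%:R by rewrite sqr_sqrtr// mulr_ge0// ltW.
have a0 : 0 < a by rewrite sqrtr_gt0 mulr_gt0.
have pointwise (t : int) :
    3 * a ^+ 2 * t%:~R ^+ 2 <= 2 * a ^+ 3 * `|t|%:~R + t%:~R ^+ 4.
  rewrite intr_norm -[t%:~R ^+ 2]real_normK ?num_real//.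
  have -> : (t%:~R : R) ^+ 4 = `|t%:~R| ^+ 4.
    by rewrite -normrX ger0_norm// exprn_even_ge0.
  set x := `|t%:~R|; have x0 : 0 <= x by rewrite normr_ge0.
  rewrite -subr_ge0 (_ : _ - _ = x * ((x - a) ^+ 2 * (x + 2 * a))); last by ring.
  by rewrite mulr_ge0// mulr_ge0 ?sqr_ge0// addr_ge0// mulr_ge0// ltW.
have := le_walk_mean m pointwise.
rewrite walk_meanZ walk_mean2 walk_meanD walk_meanZ walk_mean4 -/(mean_abs m) a2.
move=> le1; have {le1}le2 : m%:R <= a * mean_abs m.
  rewrite -(ler_pM2l m0'); move: le1; rewrite (exprS a 2) a2; nra.
have : m%:R ^+ 2 <= (a * mean_abs m) ^+ 2 by rewrite ler_sqr ?nnegrE// (le_trans (ltW m0')).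
by rewrite exprMn a2 -(ler_pM2l m0' _ (3 * _)); nra.
Qed.

(** The mean sign of the output of a majority rule on a sample of sign sum [t];
    [s] is its mean when the two labels tie. *)
Definition vote (s : R) (t : int) : R := (Num.sg t)%:~R + s * (t == 0)%:R.

Definition drift m s (w : int) : R := walk_mean m (fun t => t%:~R * vote s (w + t)).

(** By the symmetry of the walk, the tie value [s] cancels between [w] and [- w],
    and one may also average over the sign of [t]. *)
Lemma drift_pairE m s w : drift m s w + drift m s (- w) =
  walk_mean m (fun t => t%:~R * (Num.sg (w + t) + Num.sg (t - w))%:~R).
Proof.
pose h (t : int) : R := t%:~R * (vote s (w + t) + vote s (- w + t)).
have -> : drift m s w + drift m s (- w) = walk_mean m h.
  by rewrite -walk_meanD; congr walk_mean; apply/funext => t; rewrite /h; ring.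
transitivity (2^-1 * (walk_mean m h + walk_mean m (fun t => h (- t)))).
  by rewrite walk_meanN; field.
rewrite -walk_meanD -walk_meanZ; congr walk_mean; apply/funext => t.
rewrite /h /vote.
have -> : w + - t = - (- w + t) by lia.
have -> : - w + - t = - (w + t) by lia.
rewrite !sgrN !oppr_eq0 !rmorphN (addrC t (- w)) rmorphD/=.
by field.
Qed.

(** The two signs of the pair agree with that of [t] when [|t| > |w|] and cancel when
    [|t| < |w|].  In the latter case [|t| <= |w| - 1], so that the loss is at most
    [|w| - 1] and not [|w|]: this keeps [w = 1] and [w = - 1] useful even when
    [m = 1], as needed for walks of odd length, which never visit the origin. *)
Lemma drift_pair_ge m s w r : 0 <= r -> `|w|%:~R <= 1 + r ->
  mean_abs m - r <= drift m s w + drift m s (- w).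
Proof.
move=> r0 wr; rewrite drift_pairE -(walk_mean_cst m (- r)) -walk_meanD.
apply: le_walk_mean => t.
have [tw|wt] := leP (`|w|) `|t|.
  have [->|t0] := eqVneq t 0; first by rewrite normr0 mul0r add0r oppr_le0.
  have : (`|t| <= t * (Num.sg (w + t) + Num.sg (t - w)))%R.
    by case: (sgrP (w + t)); case: (sgrP (t - w)); lia.
  by rewrite -(ler_int R) intrM => le1; rewrite (le_trans _ le1)// gerDl oppr_le0.
have -> : Num.sg (w + t) + Num.sg (t - w) = 0.
  by case: (sgrP (w + t)); case: (sgrP (t - w)); lia.
rewrite mulr0 subr_le0.
have : (`|t| + 1 <= `|w|)%R by lia.
by rewrite -(ler_int R) intrD => le1; lra.
Qed.

(** Up to one step, the walk is the difference of two independent walks of half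
    the length.  It is small as soon as both halves land in the same cell of width
    [l], and by Cauchy-Schwarz this is least likely when the mass is spread evenly.
    Chebyshev's inequality puts mass at least 1/2 on the [2 J + 1] central cells,
    hence the bound [(2 J + 1) * (1 / (2 * (2 J + 1))) ^ 2]. *)
Lemma walk_concentrated N (l J : nat) : (0 < l)%N -> (0 < J)%N ->
  (N <= (J * l) ^ 2)%N ->
  (4 * (2 * J + 1)%:R)^-1 <= walk_mean N (fun w => (`|w| <= l%:Z)%R%:R).
Proof.
move=> l0 J0 NJl; pose n := N./2; pose q (u : int) := (u %/ l%:Z)%Z.
pose p (j : int) := walk_mean n (fun u => (q u == j)%:R).
set K := (2 * J + 1)%N; have K0 : 0 < K%:R :> R by rewrite ltr0n /K addn1.
have lz : (l%:Z : int) != 0 by rewrite eqz_nat -lt0n.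
(* Chebyshev: the cells numbered from -J to J carry at least half of the mass *)
have bulk : 2^-1 <= \sum_(j < K) p (j%:Z - J%:Z).
  rewrite /p -coin_mean_sum.
  have Jl0 : 0 < ((J * l)%:R ^+ 2 : R) by rewrite exprn_gt0// ltr0n muln_gt0 J0.
  apply: (@le_trans _ _ (walk_mean n (fun u => 1 + - ((J * l)%:R ^+ 2)^-1 * u%:~R ^+ 2))).
    rewrite walk_meanD walk_mean_cst walk_meanZ walk_mean2.
    suff : n%:R / ((J * l)%:R ^+ 2) <= (2^-1 : R) by rewrite mulrC; lra.
    rewrite ler_pdivrMr// mulrC ler_pdivlMr// -natrX -natrM ler_nat.
    by rewrite (leq_trans _ NJl)// muln2 -[leqRHS]odd_double_half leq_addl.
  apply: le_coin_mean => b; set u : int := \sum_j _.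
  have [qJ|qJ] := leP (`|q u|) J%:Z.
    have ltK : (absz (q u + J%:Z)%R < K)%N by rewrite /K; lia.
    rewrite (bigD1 (Ordinal ltK))//= (_ : q u == _) ?lerDl//; last by apply/eqP; lia.
    apply: le_trans (_ : 1 <= _); last by rewrite lerDl sumr_ge0.
    by rewrite gerDl mulNr oppr_le0 mulr_ge0 ?sqr_ge0// invr_ge0 ltW.
  apply: (@le_trans _ _ 0); last by rewrite sumr_ge0.
  rewrite mulNr subr_le0 mulrC ler_pdivlMr// mul1r -natrX.
  rewrite pmulrn -rmorphXn/= ler_int.
  have := divz_eq u l%:Z; have := modz_ge0 u lz.
  have := ltz_pmod u (_ : 0 < l%:Z); rewrite -/(q u).
  move=> /(_ l0) h1 h2 h3; have : (J * l)%:Z <= `|u|.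
    rewrite PoszM; move: qJ h1 h2 h3; clear; nia.
  by rewrite -[Posz (_ ^ _)]natz natrX natz -[u ^+ 2]real_normK ?num_real// ler_sqr ?nnegrE.
pose c (u : int) : R := \sum_(j < K) (q u == j%:Z - J%:Z)%:R.
have c_le1 u : c u <= 1.
  rewrite /c; have [j /eqP quj|none] := pickP (fun j : 'I_K => q u == j%:Z - J%:Z).
    rewrite (bigD1 j)//= quj eqxx big1 ?addr0// => i ij.
    case: eqP => // ji; case/eqP: ij; apply: val_inj => /=; lia.
  by rewrite big1// => j _; rewrite none.
pose close u v : R := \sum_(j < K) (q u == j%:Z - J%:Z)%:R * (q v == j%:Z - J%:Z)%:R.
have close_le (x u v : int) : (`|x| <= 1)%R ->
    close u v <= (`|x + (u - v)| <= l%:Z)%R%:R.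
  move=> x1; have -> : close u v = (q u == q v)%:R * c u.
    rewrite /close /c mulr_sumr; apply: eq_bigr => j _.
    have [->|uj] := eqVneq (q u) (j%:Z - J%:Z); last by rewrite mul0r mulr0.
    by rewrite mul1r mulr1 eq_sym.
  have [quv|_] := eqVneq (q u) (q v); last by rewrite mul0r.
  rewrite mul1r (le_trans (c_le1 u))// (_ : (`|x + (u - v)| <= l%:Z)%R = true)//.
  have := divz_eq u l%:Z; have := divz_eq v l%:Z; rewrite -/(q u) -/(q v) quv.
  have := modz_ge0 u lz; have := modz_ge0 v lz.
  have := ltz_pmod u (_ : 0 < l%:Z); have := ltz_pmod v (_ : 0 < l%:Z).
  move=> /(_ l0) + /(_ l0); move: (q v) (u %% l)%Z (v %% l)%Z x1; clear => Q mu mv.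
  move: (Q * l) => Ql; lia.
pose P : R := walk_mean n (fun u => walk_mean n (fun v => close u v)).
have Pp : P = \sum_(j < K) p (j%:Z - J%:Z) ^+ 2.
  transitivity (\sum_(j < K) walk_mean n (fun u =>
    p (j%:Z - J%:Z) * (q u == j%:Z - J%:Z)%:R)); last first.
    by apply: eq_bigr => j _; rewrite walk_meanZ expr2.
  rewrite -coin_mean_sum; apply: eq_coin_mean => b.
  rewrite [LHS]coin_mean_sum; apply: eq_bigr => j _.
  by rewrite [LHS]coin_meanZ mulrC.
(* Cauchy-Schwarz, each square being above its tangent at 1 / (2 K) *)
have P_ge : (4 * K%:R)^-1 <= P.
  have -> : (4 * K%:R)^-1 = K%:R^-1 * 2^-1 - \sum_(j < K) ((2 * K%:R)^-1) ^+ 2 :> R.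
    by rewrite sumr_const card_ord -mulr_natl; field; rewrite gt_eqF.
  rewrite Pp lerBlDr -big_split/=.
  apply: (@le_trans _ _ (\sum_(j < K) K%:R^-1 * p (j%:Z - J%:Z))).
    by rewrite -mulr_sumr ler_pM2l ?invr_gt0.
  apply: ler_sum => j _; rewrite invfM; set x := p _; set y := K%:R^-1.
  by rewrite -subr_ge0 (_ : _ - _ = (x - 2^-1 * y) ^+ 2) ?sqr_ge0//; field.
have shift x : (`|x| <= 1)%R ->
    P <= walk_mean (n + n) (fun y => (`|x + y| <= l%:Z)%R%:R).
  move=> x1; rewrite walk_mean_add; apply: le_walk_mean => u.
  by rewrite -[leRHS]walk_meanN; apply: le_walk_mean => v; apply: close_le.
(* the possible odd step is added in front of the two halves *)
rewrite (le_trans P_ge)// -[N]odd_double_half -addnn walk_mean_add -/n.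
case: (odd N); last by rewrite walk_mean0 shift.
by rewrite walk_meanS !walk_mean0 !addr0 ler_pdivlMr// mulr2n mulrDr mulr1 lerD// shift.
Qed.

End walk_estimates.

Section drift_square.
Variable R : realType.
Local Notation walk_mean := (@walk_mean R).
Local Notation mean_abs := (@mean_abs R).

(** With [M = mean_abs m], of order [sqrt m], the window of half-width
    [l], about [1 + M / 2], is where the pair of drifts at [w] and [- w] adds up to at least
    [M / 2]; about [sqrt k] cells of width [l] cover the bulk of a walk of [k * m]
    steps. *)
Lemma drift_sqr_ge m k N (s : R) : (0 < m)%N -> (0 < k)%N -> (N <= k * m)%N ->
  m%:R / (2112 * Num.sqrt k%:R) <= walk_mean N (fun w => drift m s w ^+ 2).
Proof.
move=> m0 k0 Nkm; set M := mean_abs m; set q := Num.sqrt k%:R.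
have M0 : 0 <= M.
  by rewrite -(walk_mean_cst m (0 : R)); apply: le_walk_mean => t; rewrite ler0z.
have mM : m%:R <= 3 * M ^+ 2 := mean_abs_ge R m.
have q1 : 1 <= q by rewrite -[1]sqrtr1 ler_sqrt ?ler1n.
have q2 : q ^+ 2 = k%:R by rewrite sqr_sqrtr.
pose l := (Num.truncn (M / 2)).+1; pose J := (Num.truncn (4 * q)).+1.
have lM : l%:R <= 1 + M / 2.
  by rewrite /l -natr1 [leLHS]addrC lerD2l truncn_le divr_ge0.
have Ml : M / 2 <= l%:R by rewrite ltW// truncnS_gt.
have Jq : J%:R <= 1 + 4 * q.
  by rewrite /J -natr1 [leLHS]addrC lerD2l truncn_le mulr_ge0// (le_trans _ q1).
have qJ : 4 * q <= J%:R by rewrite ltW// truncnS_gt.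
have NJl : (N <= (J * l) ^ 2)%N.
  rewrite -(ler_nat R) natrX natrM (le_trans (_ : _ <= (k * m)%:R))// ?ler_nat//.
  rewrite natrM -q2 (le_trans (_ : _ <= (4 * q * (M / 2)) ^+ 2))//; first by nra.
  by rewrite ler_sqr ?nnegrE ?ler_pM// ?mulr_ge0//; lra.
have := walk_concentrated R (ltn0Sn _) (ltn0Sn _) NJl.
rewrite -/J -/l => conc.
have pair_ge (w : int) : (`|w| <= l%:Z)%R ->
    (M / 2) ^+ 2 / 2 <= drift m s w ^+ 2 + drift m s (- w) ^+ 2.
  rewrite -(ler_int R) => wl.
  have : M - M / 2 <= drift m s w + drift m s (- w).
    by apply: drift_pair_ge; [exact: divr_ge0|exact: le_trans wl lM].
  move: (drift m s w) (drift m s (- w)) => x y xy; clear -xy M0.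
  by have := sqr_ge0 (x - y); nra.
have -> : walk_mean N (fun w => drift m s w ^+ 2) =
    walk_mean N (fun w => 2^-1 * (drift m s w ^+ 2 + drift m s (- w) ^+ 2)).
  rewrite walk_meanZ walk_meanD (walk_meanN N (fun w => drift m s w ^+ 2)).
  by field.
apply: (@le_trans _ _ (walk_mean N (fun w => M ^+ 2 / 16 * (`|w| <= l%:Z)%R%:R))).
  rewrite walk_meanZ; apply: le_trans (_ : M ^+ 2 / 16 * (44 * q)^-1 <= _).
    have qV : 0 <= q^-1 by rewrite invr_ge0 (le_trans _ q1).
    by rewrite !invfM; have := ler_wpM2r qV mM; lra.
  rewrite ler_wpM2l ?divr_ge0 ?sqr_ge0// (le_trans _ conc)//.
  have JE : 4 * (2 * J + 1)%:R = 8 * J%:R + 4 :> R by rewrite natrD natrM; ring.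
  by rewrite JE lef_pV2 ?posrE; lra.
apply: le_walk_mean => w; have [/pair_ge|_] := boolP (`|w| <= l%:Z)%R; last first.
  by rewrite mulr0 mulr_ge0 ?addr_ge0 ?sqr_ge0 ?invr_ge0.
by rewrite mulr1; lra.
Qed.

End drift_square.

(** * Correlation between the folds *)

Section cross_terms.
Variable R : realType.

Definition block_sum n k (fold : 'I_n -> 'I_k) (b : n.-tuple bool) (i : 'I_k) : int :=
  \sum_(j | fold j == i) sgnb (tnth b j).

Definition sign_sum n (b : n.-tuple bool) : int := \sum_j sgnb (tnth b j).

Definition correlation n k (fold : 'I_n -> 'I_k) (s : R) (b : n.-tuple bool) : R :=
  \sum_(i < k) (block_sum fold b i)%:~R * vote s (sign_sum b - block_sum fold b i).

(** Given the sum [r] over the other folds, swapping the votes between the two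
    factors makes them independent with mean [drift m s r] each. *)
Lemma cross_term_ge n k (fold : 'I_n -> 'I_k) (s : R) i j :
  (0 < n)%N -> (0 < k)%N -> (k %| n)%N -> balanced fold -> i != j ->
  (n %/ k)%:R / (2112 * Num.sqrt k%:R) <=
  coin_mean (fun b =>
    (block_sum fold b i)%:~R * vote s (sign_sum b - block_sum fold b i) *
    ((block_sum fold b j)%:~R * vote s (sign_sum b - block_sum fold b j))).
Proof.
move=> n0 k0 kn bal ij; set m := (n %/ k)%N.
have m0 : (0 < m)%N by rewrite divn_gt0// dvdn_leq.
pose P : pred 'I_n := [pred l | (fold l != i) && (fold l != j)].
pose Q : pred 'I_n := [pred l | fold l == i].
have thirdE l : (~~ P l && ~~ Q l) = (fold l == j).
  rewrite /P /Q /= negb_and !negbK; case: (eqVneq (fold l) i) => [->|_] /=.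
    by rewrite ?eqxx (negbTE ij).
  by rewrite andbT.
have PQ l : ~~ (P l && Q l) by rewrite /P /Q /=; case: (fold l == i); rewrite ?andbF.
pose Phi (r p q : int) : R := p%:~R * vote s (r + q) * (q%:~R * vote s (r + p)).
have -> : coin_mean (fun b =>
    (block_sum fold b i)%:~R * vote s (sign_sum b - block_sum fold b i) *
    ((block_sum fold b j)%:~R * vote s (sign_sum b - block_sum fold b j))) =
  coin_mean (fun b : n.-tuple bool =>
    Phi (\sum_(l | P l) sgnb (tnth b l)) (\sum_(l | Q l) sgnb (tnth b l))
        (\sum_(l | ~~ P l && ~~ Q l) sgnb (tnth b l))).
  apply: eq_coin_mean => b; rewrite (eq_bigl _ _ thirdE) -/(block_sum fold b i).
  rewrite -/(block_sum fold b j).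
  have -> : sign_sum b = \sum_(l | P l) sgnb (tnth b l) +
      (block_sum fold b i + block_sum fold b j).
    rewrite addrC /sign_sum (bigID Q)/= -/(block_sum fold b i) -addrA; congr (_ + _).
    rewrite (bigID (fun l => fold l == j))/=; congr (_ + _).
    apply: eq_bigl => l; rewrite /Q /=.
    by case: (eqVneq (fold l) j) => [->|]; rewrite ?andbF// eq_sym ij.
  by rewrite /Phi; congr (_ * vote _ _ * (_ * vote _ _)); ring.
rewrite coin_mean_blocks//.
have cardm i' : #|[pred l | fold l == i']| = m.
  by rewrite /m -(bal i') cardsE.
have -> : #|Q| = m by exact: cardm.
have -> : #|[pred l | ~~ P l && ~~ Q l]| = m.
  by rewrite -(cardm j); apply: eq_card; exact: thirdE.
have -> : (fun r => walk_mean m (fun p => walk_mean m (fun q => Phi r p q))) =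
    (fun r => drift m s r ^+ 2).
  apply/funext => r; rewrite expr2 {1}/drift mulrC -walk_meanZ.
  congr walk_mean; apply/funext => p; rewrite mulrC /drift -walk_meanZ.
  by congr walk_mean; apply/funext => q; rewrite /Phi; ring.
apply: drift_sqr_ge => //.
by rewrite mulnC divnK// (leq_trans (max_card _))// card_ord.
Qed.

(** Only the [k * (k - 1)] off-diagonal terms of the square are kept, those on the
    diagonal being nonnegative. *)
Lemma correlation_sqr_ge n k (fold : 'I_n -> 'I_k) (s : R) :
  (0 < n)%N -> (2 <= k)%N -> (k %| n)%N -> balanced fold ->
  n%:R * Num.sqrt k%:R / 4224 <= coin_mean (fun b => correlation fold s b ^+ 2).
Proof.
move=> n0 k2 kn bal; have k0 : (0 < k)%N := ltnW k2.
set q := Num.sqrt k%:R.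
have q0 : 0 < q by rewrite sqrtr_gt0 ltr0n.
have q2 : q ^+ 2 = k%:R by rewrite sqr_sqrtr.
pose x i b : R := (block_sum fold b i)%:~R * vote s (sign_sum b - block_sum fold b i).
apply: (@le_trans _ _ (\sum_(i < k) \sum_(j < k | i != j)
    coin_mean (fun b => x i b * x j b))); last first.
  rewrite [leLHS](_ : _ = coin_mean (fun b =>
      \sum_(i < k) \sum_(j < k | i != j) x i b * x j b)); last first.
    by rewrite coin_mean_sum; apply: eq_bigr => i _; rewrite coin_mean_sum.
  apply: le_coin_mean => b; rewrite expr2 /correlation mulr_suml.
  apply: ler_sum => i _; rewrite mulr_sumr [leRHS](bigD1 i)//= -[leLHS]add0r.
  rewrite lerD -?expr2 ?sqr_ge0//.
  by rewrite (eq_bigl (fun j => j != i))// => j; rewrite eq_sym.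
apply: (@le_trans _ _ (\sum_(i < k) \sum_(j < k | i != j)
    (n %/ k)%:R / (2112 * q))); last first.
  apply: ler_sum => i _; apply: ler_sum => j ij.
  exact: cross_term_ge.
set C := _ / _.
have inner (i : 'I_k) : \sum_(j < k | i != j) C = C *+ k.-1.
  rewrite -[in RHS](card_ord k) -(cardC1 i) -sumr_const.
  by apply: eq_bigl => j; rewrite inE eq_sym.
under eq_bigr do rewrite inner.
rewrite sumr_const card_ord -mulrnA -[leRHS]mulr_natl natrM -subn1 natrB// -q2.
have -> : C = n%:R / (2112 * q ^+ 3).
  have -> : n%:R = (n %/ k)%:R * q ^+ 2 by rewrite q2 -natrM divnK.
  by rewrite /C; field; rewrite gt_eqF.
have -> : (q ^+ 2 - 1) * q ^+ 2 * (n%:R / (2112 * q ^+ 3)) =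
    n%:R * (q - q^-1) / 2112 by field; rewrite gt_eqF.
have qV : q^-1 <= q / 2.
  by rewrite -(ler_pM2l q0) mulfV ?gt_eqF// mulrA -expr2 q2 ler_pdivlMr// mul1r ler_nat.
have : n%:R * (q / 2) <= n%:R * (q - q^-1) by rewrite ler_wpM2l//; lra.
by lra.
Qed.

End cross_terms.

(** * Integration against coin laws *)

Section measure_lemmas.
Context d (T : measurableType d) (R : realType).
Implicit Type P : probability T R.

Lemma bounded_integrable P (f : T -> R) (M : R) : measurable_fun setT f ->
  (forall x, `|f x| <= M) -> P.-integrable setT (EFin \o f).
Proof.
move=> mf fM; apply: measurable_bounded_integrable => //.
  by rewrite (le_lt_trans (probability_le1 P measurableT))// ltry.
by exists M; split=> [|r Mr x _ /=]; [exact: num_real|exact: le_trans (ltW Mr)].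
Qed.

Lemma integrable_mulr P (f : T -> R) (c : R) :
  P.-integrable setT (EFin \o f) -> P.-integrable setT (EFin \o (fun x => c * f x)).
Proof. by move=> intf; have := integrableZl measurableT c intf; apply. Qed.

Lemma integrable_sumr P (I : Type) (s : seq I) (Q : pred I) (f : I -> T -> R) :
  (forall i, P.-integrable setT (EFin \o f i)) ->
  P.-integrable setT (EFin \o (fun x => \sum_(i <- s | Q i) f i x)).
Proof.
move=> intf; rewrite (_ : _ \o _ = (fun x => \sum_(i <- s | Q i) (f i x)%:E)%E).
  by apply: integrable_sum => // i _; exact: intf.
by rewrite boolp.funeqE => x; rewrite /= sumEFin.
Qed.

Lemma Rintegral_sum P (I : Type) (s : seq I) (Q : pred I) (f : I -> T -> R) :
  (forall i, P.-integrable setT (EFin \o f i)) ->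
  \int[P]_x (\sum_(i <- s | Q i) f i x) = \sum_(i <- s | Q i) \int[P]_x f i x.
Proof.
move=> intf; have intS r := integrable_sumr r Q intf.
elim: s => [|i s IH].
  by under eq_Rintegral do rewrite big_nil; rewrite Rintegral_cst// mul0r big_nil.
rewrite big_cons -IH; case: ifP => Qi; last first.
  by apply: eq_Rintegral => x _; rewrite big_cons Qi.
rewrite -RintegralD//; apply: eq_Rintegral => x _; by rewrite big_cons Qi.
Qed.

Lemma Rintegral_cstT P (c : R) : \int[P]_x c = c.
Proof.
transitivity (c * fine (P [set: T])); first exact: Rintegral_cst.
by rewrite (probability_setT P) mulr1.
Qed.

(** Jensen's inequality for the square, from the nonnegativity of the variance. *)
Lemma Rintegral_sqr_ge P (f : T -> R) (M : R) : measurable_fun setT f ->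
  (forall x, `|f x| <= M) ->
  (((\int[P]_x f x) ^+ 2)%:E <= \int[P]_x (f x ^+ 2)%:E)%E.
Proof.
move=> mf fM; set a := \int[P]_x f x.
have intf := bounded_integrable P mf fM.
have intf2 : P.-integrable setT (EFin \o (fun x => f x ^+ 2)).
  apply: (@bounded_integrable _ _ (M ^+ 2)); first exact: measurable_funX.
  move=> x; rewrite normrX ler_sqr ?nnegrE// (le_trans _ (fM x))//.
have inta : P.-integrable setT (EFin \o (fun x => 2 * a * f x)).
  exact: integrable_mulr.
have intc : P.-integrable setT (EFin \o (fun=> a ^+ 2)).
  exact: (@bounded_integrable _ _ `|a ^+ 2|).
rewrite -[leRHS]fineK ?integrable_fin_num// lee_fin -/(Rintegral _ _ _).
rewrite -subr_ge0.
have -> : \int[P]_x (f x ^+ 2) - a ^+ 2 = \int[P]_x ((f x - a) ^+ 2).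
  transitivity (\int[P]_x (f x ^+ 2 - 2 * a * f x + a ^+ 2)); last first.
    by apply: eq_Rintegral => x _; ring.
  rewrite RintegralD//; last first.
    by apply: (integrableB _ intf2 inta).
  rewrite RintegralB// RintegralZl// Rintegral_cstT -/a; ring.
by apply: Rintegral_ge0 => x _; exact: sqr_ge0.
Qed.

(** The integral of a nonnegative function is a supremum over the simple functions
    below it, so it is monotone on arbitrary functions.  This applies to the inner
    integrals of the mean squared error as functions of the outer variables. *)
Lemma le_integral_nneg (mu : {measure set T -> \bar R}) (f g : T -> \bar R) :
  (forall x, 0 <= f x)%E -> (forall x, f x <= g x)%E ->
  (\int[mu]_x f x <= \int[mu]_x g x)%E.
Proof.
move=> f0 fg; rewrite !ge0_integralTE//; last by move=> x; exact: le_trans (fg x).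
by apply: le_ereal_sup => _ [h hf <-]; exists h => // x; exact: le_trans (fg x).
Qed.

End measure_lemmas.

Section probability_kernel.
Context d d' (T : measurableType d) (H : measurableType d') (R : realType).
Variable kappa : T -> probability H R.
Hypothesis mkappa : forall U, measurable U -> measurable_fun setT (fun x => kappa x U).

Let K : T -> {measure set H -> \bar R} := kappa.
HB.instance Definition _ := @isKernel.Build _ _ T H R K mkappa.
Let K_uub : measure_fam_uub K.
Proof.
exists 2 => x; rewrite (le_lt_trans (probability_le1 (kappa x) measurableT))//.
by rewrite lte_fin ltr1n.
Qed.
HB.instance Definition _ := @Kernel_isFinite.Build _ _ T H R K K_uub.

(** Needed to see that the probability of an error of the rule, at a point that is
    itself part of the sample, is a measurable function of the sample. *)
Lemma measurable_kernel_section (B : set (T * H)) : measurable B ->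
  measurable_fun setT (fun x => kappa x (xsection B x)).
Proof.
move=> mB; have := @measurable_fun_xsection_finite_kernel _ _ _ _ _ K B.
by apply; rewrite inE.
Qed.

End probability_kernel.

Section coin_probability.
Context d (T : measurableType d) (R : realType) (z : bool -> T).

Let mz : measurable_fun [set: bool] z. Proof. by []. Qed.
HB.instance Definition _ := isMeasurableFun.Build _ _ _ _ z mz.

(** The law that charges [z true] and [z false] with mass 1/2, as an image measure:
    singletons need not be measurable. *)
Definition coin_prob : probability T R := distribution (bernoulli_prob 2^-1) z.

Let half01 : 0 <= (2^-1 : R) <= 1.
Proof. by rewrite invr_ge0 ler0n invf_le1 ?ler1n. Qed.

Lemma integral_coin_prob (f : T -> \bar R) : measurable_fun setT f ->
  (forall x, 0 <= f x)%E ->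
  (\int[coin_prob]_x f x = 2^-1%:E * f (z true) + 2^-1%:E * f (z false))%E.
Proof.
move=> mf f0; rewrite ge0_integral_distribution// integral_bernoulli_prob//=.
rewrite (_ : unstable.onem 2^-1 = 2^-1 :> R)// /unstable.onem.
by field.
Qed.

Lemma coin_probE (U : set T) : measurable U ->
  fine (coin_prob U) = (\1_U (z true) + \1_U (z false)) / 2.
Proof.
move=> mU; rewrite -[U in coin_prob U]setIT -integral_indic// integral_coin_prob//=.
- by rewrite -mulrDr mulrC.
- by apply/measurable_EFinP; exact: measurable_indic.
Qed.

(** Integrals over a sample of this law are finite averages: Tonelli's theorem
    peels off one observation at a time. *)
Lemma integral_tuple_coin n (G : n.-tuple T -> R) : measurable_fun setT G ->
  (forall S, 0 <= G S) ->
  (\int[tuple_prob (fun _ : 'I_n => coin_prob)]_S (G S)%:E)%E =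
  (coin_mean (fun b => G [tuple z (tnth b j) | j < n]))%:E.
Proof.
elim: n G => [|n IH] G mG G0.
  rewrite /= integral_dirac//; last exact/measurable_EFinP.
  by rewrite diracT mul1e; congr (G _)%:E; exact/esym/tuple0.
have mGt c : measurable_fun setT (fun t : n.-tuple T => G (tcons (c, t))).
  apply: (measurableT_comp mG).
  exact: (@measurable_cons _ _ _ _ (fun=> c) _ id (measurable_cst _) (@measurable_id _ _ _)).
have mGc : measurable_fun setT (fun p : T * n.-tuple T => (G (tcons p))%:E).
  apply/measurable_EFinP; apply: (measurableT_comp mG); exact: measurable_tcons.
have Gc0 p : (0 <= (G (tcons p))%:E)%E by rewrite lee_fin.
pose mu : probability (n.-tuple T) R := tuple_prob (fun _ : 'I_n => coin_prob).
transitivity (\int[prod_prob coin_prob mu]_p (G (tcons p))%:E)%E.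
  apply: ge0_integral_distribution; first exact/measurable_EFinP.
  by move=> S; rewrite lee_fin.
transitivity (\int[coin_prob]_x \int[mu]_t (G (tcons (x, t)))%:E)%E.
  exact: (@fubini_tonelli1 _ _ _ _ _ _ _ (fun p => (G (tcons p))%:E)).
rewrite integral_coin_prob; last 2 first.
- exact: (@measurable_fun_fubini_tonelli_F _ _ _ _ _ _ (fun p => (G (tcons p))%:E)).
- by move=> x; apply: integral_ge0 => t _; rewrite lee_fin.
rewrite !IH// -!EFinM -EFinD -mulrDr mulrC; congr ((_ + _) / 2)%:E.
all: apply: eq_coin_mean => b; congr G; apply: eq_from_tnth => j.
all: rewrite !tnth_mktuple /tcons; case: (unliftP ord0 j) => [l|] ->.
all: by rewrite ?tnthS ?tnth_mktuple ?tnth0.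
Qed.

End coin_probability.

(** * The conditional mean of the cross-validation gap *)

Section rule.
Context (R : realType) (dX dY dH : measure_display).
Context (X : measurableType dX) (Y : measurableType dY) (H : measurableType dH).
Variable ev : H -> X -> Y.
Hypothesis ev_meas : measurable_error ev.
Variable A : forall n, n.-tuple (X * Y) -> probability H R.
Hypothesis A_meas : measurable_rule A.

Definition miss_set (z : X * Y) : set H := [set h | ev h z.1 != z.2].

(** The probability, over the internal randomness of the rule, that its output on
    [S] errs at [z]. *)
Definition miss n (S : n.-tuple (X * Y)) (z : X * Y) : R := fine (A S (miss_set z)).

Lemma measurable_miss_set z : measurable (miss_set z).
Proof.
have := measurable_ysection z ev_meas.
by congr measurable; apply/seteqP; split=> h; rewrite /ysection/= inE.
Qed.

Lemma measurable_error_set h : measurable (error_set ev h).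
Proof.
have := measurable_xsection h ev_meas.
by congr measurable; apply/seteqP; split=> z; rewrite /xsection/= inE.
Qed.

Lemma loss01_missE h z : loss01 ev h z = \1_(miss_set z) h :> R.
Proof.
rewrite indicE /loss01; congr (nat_of_bool _)%:R.
by apply/idP/idP => [e|]; [exact: mem_set|rewrite inE].
Qed.

Lemma loss01_errorE h z : loss01 ev h z = \1_(error_set ev h) z :> R.
Proof.
rewrite indicE /loss01; congr (nat_of_bool _)%:R.
by apply/idP/idP => [e|]; [exact: mem_set|rewrite inE].
Qed.

Lemma loss01_ge0 h z : 0 <= loss01 ev h z :> R. Proof. by []. Qed.
Lemma loss01_le1 h z : loss01 ev h z <= 1 :> R.
Proof. by rewrite /loss01; case: (_ != _). Qed.

Lemma measurable_loss01 z : measurable_fun setT (fun h => loss01 ev h z : R).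
Proof.
rewrite (_ : (fun h => _) = \1_(miss_set z)); last first.
  by apply/funext => h; rewrite loss01_missE.
exact/measurable_indic/measurable_miss_set.
Qed.

Lemma Rintegral_loss01 (P : probability H R) z :
  \int[P]_h loss01 ev h z = fine (P (miss_set z)).
Proof.
rewrite /Rintegral; congr fine.
under eq_integral do rewrite loss01_missE.
by rewrite integral_indic ?setIT//; exact: measurable_miss_set.
Qed.

Lemma risk_coin z h : risk ev (coin_prob R z) h =
  (loss01 ev h (z true) + loss01 ev h (z false)) / 2.
Proof. by rewrite /risk coin_probE ?loss01_errorE//; exact: measurable_error_set. Qed.

Lemma measurable_miss n p (tau : n.-tuple (X * Y) -> p.-tuple (X * Y)) (j : 'I_n) :
  measurable_fun setT tau ->
  measurable_fun setT (fun S => miss (tau S) (tnth S j)).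
Proof.
move=> mtau.
pose B := [set q : n.-tuple (X * Y) * H | error_set ev q.2 (tnth q.1 j)].
have mB : measurable B.
  have mf : measurable_fun setT
      (fun q : n.-tuple (X * Y) * H => (q.2, tnth q.1 j)).
    apply: measurable_fun_pair => //.
    by apply: (measurableT_comp (measurable_tnth j)).
  by have := mf measurableT _ ev_meas; rewrite setTI.
have mk (U : set H) : measurable U -> measurable_fun setT (fun S => A (tau S) U).
  by move=> mU; apply: (measurableT_comp (A_meas mU)).
have := measurable_kernel_section mk mB.
move=> /(measurableT_comp (@fine_measurable R _ measurableT)).
by congr measurable_fun; apply/funext => S; rewrite /miss /=; congr (fine (A _ _));
  apply/seteqP; split=> h; rewrite /xsection/= inE.
Qed.

Section folds.
Variables (n k : nat) (fold : 'I_n -> 'I_k).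
Local Notation m := (n %/ k)%N.

Lemma measurable_training_sample i :
  measurable_fun setT (fun S : n.-tuple (X * Y) => training_sample fold S i).
Proof.
apply/measurable_fun_tnthP => j.
rewrite (_ : _ \o _ = fun S => tnth S (enum_val j)); first exact: measurable_tnth.
by apply/funext => S; rewrite /= tnth_mktuple.
Qed.

(** The mean of the cross-validation estimate minus the risk, given the sample [S],
    for the coin distribution on the two points of [z]. *)
Definition mean_gap (z : bool -> X * Y) (S : n.-tuple (X * Y)) : R :=
  k%:R^-1 * (\sum_(i < k) m%:R^-1 *
    (\sum_(j in fold_set fold i) miss (training_sample fold S i) (tnth S j)))
  - (miss S (z true) + miss S (z false)) / 2.

Lemma Rintegral_tuple_prob p (mu : 'I_p -> probability H R) i z :
  \int[tuple_prob mu]_hs loss01 ev (tnth hs i) z = fine (mu i (miss_set z)).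
Proof.
pose E := [set hs : p.-tuple H | miss_set z (tnth hs i)].
pose B l := if l == i then miss_set z else setT.
have mB l : measurable (B l).
  by rewrite /B; case: ifP => // _; exact: measurable_miss_set.
have EB : E = [set hs : p.-tuple H | forall l, B l (tnth hs l)].
  apply/seteqP; split=> hs /=; first by move=> h l; rewrite /B; case: eqP => // ->.
  by move=> /(_ i); rewrite /B eqxx.
have mE : measurable E by rewrite EB; exact: measurable_box.
transitivity (fine (tuple_prob mu E)).
  rewrite /Rintegral; congr fine.
  rewrite -[E in RHS]setIT -integral_indic//; apply: eq_integral => hs _.
  by rewrite loss01_missE !indicE.
rewrite EB tuple_probE// (bigD1 i)//= big1 ?mule1; last first.
  by move=> l li; rewrite /B (negbTE li) (probability_setT (mu l)).
by rewrite /B eqxx.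
Qed.

Lemma integrable_loss01 (P : probability H R) z :
  P.-integrable setT (EFin \o (fun h => loss01 ev h z : R)).
Proof.
apply: (@bounded_integrable _ _ _ _ _ 1); first exact: measurable_loss01.
by move=> h; rewrite ger0_norm ?loss01_ge0 ?loss01_le1.
Qed.

Lemma integrable_tuple_loss01 p (P : probability (p.-tuple H) R) i z :
  P.-integrable setT (EFin \o (fun hs => loss01 ev (tnth hs i) z : R)).
Proof.
apply: (@bounded_integrable _ _ _ _ _ 1).
  by apply: (measurableT_comp (measurable_loss01 z)); exact: measurable_tnth.
by move=> h; rewrite ger0_norm ?loss01_ge0 ?loss01_le1.
Qed.

(** Jensen's inequality, once for the hypotheses trained on the folds and once for
    the hypothesis trained on the whole sample. *)
Lemma inner_mse_ge z (S : n.-tuple (X * Y)) :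
  ((mean_gap z S ^+ 2)%:E <=
   \int[tuple_prob (fun i : 'I_k => A (training_sample fold S i))]_hs
      \int[A S]_h ((cv_estimate ev fold S hs - risk ev (coin_prob R z) h) ^+ 2)%:E)%E.
Proof.
set mu := fun i : 'I_k => _.
pose rho : R := (miss S (z true) + miss S (z false)) / 2.
pose cv hs : R := cv_estimate ev fold S hs.
pose rk h : R := risk ev (coin_prob R z) h.
have rkE : rk = fun h => 2^-1 * (loss01 ev h (z true) + loss01 ev h (z false)).
  by apply/funext => h; rewrite /rk risk_coin mulrC.
have int_loss2 : (A S).-integrable setT
    (EFin \o (fun h => loss01 ev h (z true) + loss01 ev h (z false) : R)).
  by have := integrableD measurableT (integrable_loss01 (A S) (z true))
    (integrable_loss01 (A S) (z false)); apply.
have int_rk : (A S).-integrable setT (EFin \o rk).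
  by rewrite rkE; exact: integrable_mulr.
have risk_int (c : R) : \int[A S]_h (c - rk h) = c - rho.
  rewrite RintegralB//; last exact: (@bounded_integrable _ _ _ _ _ `|c|).
  rewrite Rintegral_cstT rkE RintegralZl// RintegralD//; try exact: integrable_loss01.
  by rewrite !Rintegral_loss01 mulrC.
have int_fold i : (tuple_prob mu).-integrable setT
    (EFin \o (fun hs => fold_error ev fold S i (tnth hs i) : R)).
  apply: integrable_mulr; apply: integrable_sumr => j.
  exact: integrable_tuple_loss01.
have int_cv : (tuple_prob mu).-integrable setT (EFin \o cv).
  by apply: integrable_mulr; exact: integrable_sumr.
have cv_int : \int[tuple_prob mu]_hs (cv hs - rho) = mean_gap z S.
  rewrite RintegralB//; last exact: (@bounded_integrable _ _ _ _ _ `|rho|).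
  rewrite Rintegral_cstT; congr (_ - _).
  rewrite /cv /cv_estimate RintegralZl//; last exact: integrable_sumr.
  rewrite Rintegral_sum//; congr (_ * _); apply: eq_bigr => i _.
  rewrite /fold_error RintegralZl//; last first.
    by apply: integrable_sumr => j; exact: integrable_tuple_loss01.
  rewrite Rintegral_sum; last by move=> j; exact: integrable_tuple_loss01.
  by congr (_ * _); apply: eq_bigr => j _; rewrite Rintegral_tuple_prob.
pose B : R := k%:R^-1 * (\sum_(i < k) m%:R^-1 * (\sum_(j in fold_set fold i) 1)).
have cvB hs : `|cv hs| <= B.
  have fold_ge0 i : 0 <= fold_error ev fold S i (tnth hs i) :> R.
    by rewrite mulr_ge0 ?invr_ge0// sumr_ge0.
  rewrite ger0_norm; last by rewrite mulr_ge0 ?invr_ge0// sumr_ge0.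
  rewrite ler_wpM2l ?invr_ge0//; apply: ler_sum => i _.
  by rewrite ler_wpM2l ?invr_ge0//; apply: ler_sum => j _; exact: loss01_le1.
have rk01 h : 0 <= rk h <= 1.
  rewrite rkE; have := loss01_ge0 h (z true); have := loss01_ge0 h (z false).
  by have := loss01_le1 h (z true); have := loss01_le1 h (z false); lra.
apply: (@le_trans _ _ (\int[tuple_prob mu]_hs ((cv hs - rho) ^+ 2)%:E)%E).
  rewrite -cv_int; apply: (@Rintegral_sqr_ge _ _ _ _ _ (B + `|rho|)).
    by apply: measurable_funB => //; have /integrableP[/measurable_EFinP] := int_cv.
  by move=> hs; rewrite (le_trans (ler_normB _ _))// lerD2r.
apply: le_integral_nneg => hs; first by rewrite lee_fin sqr_ge0.
rewrite -risk_int.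
apply: (@Rintegral_sqr_ge _ _ _ _ _ (`|cv hs| + 1)).
  by apply: measurable_funB => //; have /integrableP[/measurable_EFinP] := int_rk.
move=> h; rewrite (le_trans (ler_normB _ _))// lerD2l.
by case/andP: (rk01 h) => rk0 rk1; rewrite ger0_norm.
Qed.

Lemma measurable_mean_gap z : measurable_fun setT (mean_gap z).
Proof.
apply: measurable_funB.
  apply: measurable_funM => //; apply: measurable_sum => i.
  apply: measurable_funM => //.
  rewrite (_ : (fun S => _) = (fun S => \sum_(j <- enum (fold_set fold i))
    miss (training_sample fold S i) (tnth S j))); last first.
    by apply/funext => S; rewrite big_enum.
  apply: measurable_sum => j; apply: measurable_miss.
  exact: measurable_training_sample.
apply: measurable_funM => //.
have mm c : measurable_fun setT (fun S : n.-tuple (X * Y) => miss S (z c)).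
  rewrite /miss; apply: (measurableT_comp (@fine_measurable R _ measurableT)).
  exact: (A_meas (measurable_miss_set (z c))).
exact: measurable_funD.
Qed.

Lemma cv_mse_coin_ge z :
  ((coin_mean (fun b => mean_gap z [tuple z (tnth b j) | j < n] ^+ 2))%:E <=
   cv_mse ev A fold (coin_prob R z))%E.
Proof.
rewrite -(@integral_tuple_coin _ _ _ z n (fun S => mean_gap z S ^+ 2)); last 2 first.
- by apply: measurable_funX; exact: measurable_mean_gap.
- by move=> S; exact: sqr_ge0.
apply: le_integral_nneg => S; first by rewrite lee_fin sqr_ge0.
exact: inner_mse_ge.
Qed.

End folds.
End rule.

(** * Empirical risk minimization as a majority vote *)

Section majority.
Context (R : realType) (dX dY dH : measure_display).
Context (X : measurableType dX) (Y : measurableType dY) (H : measurableType dH).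
Variable ev : H -> X -> Y.
Hypothesis ev_meas : measurable_error ev.
Variable A : forall n, n.-tuple (X * Y) -> probability H R.
Hypothesis A_perm : permutation_invariant A.
Hypothesis A_ERM : is_ERM ev A.
Variables (x0 : X) (hyp : bool -> H).
Hypothesis hyp_neq : ev (hyp true) x0 <> ev (hyp false) x0.

Definition atom (c : bool) : X * Y := (x0, ev (hyp c) x0).

Definition coin_sample n (b : n.-tuple bool) : n.-tuple (X * Y) :=
  [tuple atom (tnth b j) | j < n].

Local Notation loss h c := (loss01 ev h (atom c) : R).

Lemma loss_hypE c c' : loss (hyp c) c' = (c != c')%:R.
Proof.
rewrite /loss01 /atom /=; congr (nat_of_bool _)%:R.
by case: c c' => -[]; rewrite ?eqxx//; apply/eqP => // /esym.
Qed.

(** No hypothesis is correct at both points, as they carry distinct labels. *)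
Lemma loss_sum_ge1 h : 1 <= loss h true + loss h false.
Proof.
rewrite /loss01 /atom /=; have [et|] := eqVneq; last by rewrite lerDl.
by have [ef|] := eqVneq; [case: hyp_neq; rewrite -et -ef|rewrite add0r].
Qed.

(** The empirical error is affine in the two losses, and its slope in their
    difference has the sign of the sum of the labels: this is the majority vote. *)
Lemma empirical_errorE n (b : n.-tuple bool) h : (0 < n)%N ->
  empirical_error ev (coin_sample b) h = (loss h true + loss h false) / 2 +
    (sign_sum b)%:~R / n%:R * ((loss h true - loss h false) / 2).
Proof.
move=> n0; rewrite /empirical_error.
under eq_bigr => j _.
  rewrite tnth_mktuple (_ : loss01 _ _ _ = (loss h true + loss h false) / 2 +
    (sgnb (tnth b j))%:~R * ((loss h true - loss h false) / 2)); last first.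
    by case: (tnth b j); rewrite /sgnb /= ?rmorphN/=; field.
  over.
rewrite big_split/= sumr_const card_ord -mulr_suml -rmorph_sum/= -/(sign_sum b).
by rewrite -mulr_natl; field; rewrite pnatr_eq0 -lt0n.
Qed.

(** Compared with [hyp true] and [hyp false], a minimizer errs at exactly one of the
    two points, and not at the majority one. *)
Lemma ae_optimal n (b : n.-tuple bool) : (0 < n)%N ->
  {ae A (coin_sample b), forall h, [/\ loss h true + loss h false = 1,
    0 < sign_sum b -> loss h true = 0 & sign_sum b < 0 -> loss h false = 0]}.
Proof.
move=> n0; apply: filterS (A_ERM (coin_sample b)) => h hmin.
have := hmin (hyp true); have := hmin (hyp false).
rewrite !empirical_errorE// !loss_hypE /=.
have := loss_sum_ge1 h.
set t := _ / n%:R => sum_ge1.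
have tpos : 0 < sign_sum b -> 0 < t by move=> T0; rewrite divr_gt0 ?ltr0z ?ltr0n.
have tneg : sign_sum b < 0 -> t < 0 by move=> T0; rewrite pmulr_llt0 ?ltrz0 ?invr_gt0 ?ltr0n.
move: sum_ge1; rewrite /loss01.
case: (_ != _); case: (_ != _) => /= h1 h2 h3; split=> //; try lra.
all: try by move=> /tpos; lra.
all: try by move=> /tneg; lra.
Qed.

Local Notation missA b c := (miss ev A (coin_sample b) (atom c)).

Lemma miss0 n (b : n.-tuple bool) c :
  {ae A (coin_sample b), forall h, loss h c = 0} -> missA b c = 0.
Proof.
move=> [N [mN N0 subN]]; rewrite /miss.
have : (A (coin_sample b) (miss_set ev (atom c)) <= A (coin_sample b) N)%E.
  apply: le_measure; rewrite ?inE//; first exact: measurable_miss_set.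
  move=> h hm; apply: subN => /= /eqP; rewrite loss01_missE indicE mem_set//.
  by rewrite oner_eq0.
by rewrite N0 measure_le0 => /eqP ->.
Qed.

Lemma miss_sum1 n (b : n.-tuple bool) : (0 < n)%N ->
  missA b true + missA b false = 1.
Proof.
move=> n0; rewrite /miss -!Rintegral_loss01//.
rewrite -RintegralD//; try exact: integrable_loss01.
transitivity (\int[A (coin_sample b)]_h (1 : R)); last exact: Rintegral_cstT.
rewrite /Rintegral; congr fine; apply: ae_eq_integral => //.
- apply/measurable_EFinP; apply: measurable_funD; exact: measurable_loss01.
- by apply: filterS (ae_optimal b n0) => h [-> _ _] _.
Qed.

Lemma sign_sum_count n (b : n.-tuple bool) : sign_sum b = (count id b)%:Z *+ 2 - n%:Z.
Proof.
rewrite /sign_sum -(big_tuple _ _ b predT sgnb).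
have -> : n%:Z = (size b)%:Z by rewrite size_tuple.
elim: (tval b) => [|c s IH]; first by rewrite big_nil.
by rewrite big_cons IH /sgnb; case: c => /=; lia.
Qed.

Lemma perm_eq_sign_sum n (b b' : n.-tuple bool) : sign_sum b = sign_sum b' -> perm_eq b b'.
Proof.
rewrite !sign_sum_count => tot; have {tot} cb : count id b = count id b' by lia.
have countE (p : pred bool) (s : seq bool) :
    count p s = (p true * count id s + p false * (size s - count id s))%N.
  elim: s => [|c s IH] /=; first by lia.
  by have := count_size id s; rewrite IH; case: c; case: (p true); case: (p false); lia.
by apply/seq.permP => p; rewrite countE [RHS]countE cb !size_tuple.
Qed.

(** Two coin samples with the same sum of labels are permutations of each other. *)
Lemma miss_sign_sum n (b b' : n.-tuple bool) c : sign_sum b = sign_sum b' ->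
  missA b c = missA b' c.
Proof.
move=> /perm_eq_sign_sum/tuple_permP[s bs].
have -> : coin_sample b = [tuple tnth (coin_sample b') (s i) | i < n].
  apply: eq_from_tnth => j; rewrite !tnth_mktuple (_ : b = [tuple tnth b' (s i) | i < n]).
    by rewrite tnth_mktuple.
  exact: val_inj.
by rewrite /miss A_perm//; exact: measurable_miss_set.
Qed.

(** The bias at a tie depends on the size of the sample only, which makes it
    common to all the folds. *)
Lemma miss_vote : exists s : nat -> R, forall n (b : n.-tuple bool), (0 < n)%N ->
  missA b false - missA b true = vote (s n) (sign_sum b).
Proof.
suff : forall n, exists s : R, forall b : n.-tuple bool, (0 < n)%N ->
    missA b false - missA b true = vote s (sign_sum b).
  by move=> /boolp.choice[s sP]; exists s.
move=> n.
have vote_sg (s : R) (b : n.-tuple bool) : (0 < n)%N -> sign_sum b != 0 ->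
    missA b false - missA b true = vote s (sign_sum b).
  move=> n0 T0; have sum1 := miss_sum1 b n0; rewrite /vote (negbTE T0) mulr0 addr0.
  have := ae_optimal b n0; case: (sgrP (sign_sum b)) T0 => // T _ opt.
    by have e : missA b true = 0;
      [apply: miss0; apply: filterS opt => h [_ + _]; exact|
       rewrite -sum1 e; ring].
  by have e : missA b false = 0;
      [apply: miss0; apply: filterS opt => h [_ _ +]; exact|
       rewrite rmorphN /= -sum1 e; ring].
have [[b0 Tb0]|none] := pselect (exists b : n.-tuple bool, sign_sum b = 0).
  exists (missA b0 false - missA b0 true) => b n0.
  have [Tb|] := eqVneq (sign_sum b) 0; last exact: vote_sg.
  by rewrite !(@miss_sign_sum _ b b0) ?Tb// /vote sgr0 eqxx mulr1 add0r.
exists 0 => b n0; apply: vote_sg => //.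
by apply/eqP => Tb; apply: none; exists b.
Qed.

(** All training samples have size [n - m], hence a single tie value [s]; the
    constant 1/2 of the fold errors cancels against the risk. *)
Lemma mean_gap_correlation n k (fold : 'I_n -> 'I_k) : (0 < n)%N -> (2 <= k)%N ->
  (k %| n)%N -> balanced fold -> exists s : R, forall b : n.-tuple bool,
  mean_gap ev A fold atom (coin_sample b) = - (2 * n%:R)^-1 * correlation fold s b.
Proof.
move=> n0 k2 kn bal; have [s sP] := miss_vote.
set m := (n %/ k)%N.
have k0 : (0 < k)%N := ltnW k2.
have m0 : (0 < m)%N by rewrite divn_gt0// dvdn_leq.
have nkm : n = (k * m)%N by rewrite mulnC divnK.
exists (s (n - m)%N) => b.
rewrite /mean_gap miss_sum1//.
have foldE (i : 'I_k) : m%:R^-1 * (\sum_(j in fold_set fold i)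
    miss ev A (training_sample fold (coin_sample b) i) (tnth (coin_sample b) j)) =
    2^-1 - (2 * m%:R)^-1 * ((block_sum fold b i)%:~R *
      vote (s (n - m)%N) (sign_sum b - block_sum fold b i)).
  have block_sumE : block_sum fold b i = \sum_(j in fold_set fold i) sgnb (tnth b j).
    by apply: eq_bigl => j; rewrite finset.in_set.
  pose bi : #|~: fold_set fold i|.-tuple bool := [tuple tnth b (enum_val j) | j < _].
  have cardi : #|~: fold_set fold i| = (n - m)%N by rewrite cardsCs finset.setCK card_ord bal.
  have bi0 : (0 < #|~: fold_set fold i|)%N.
    by rewrite cardi nkm; nia.
  have -> : training_sample fold (coin_sample b) i = coin_sample bi.
    by apply: eq_from_tnth => j; rewrite !tnth_mktuple.
  have Tbi : sign_sum bi = sign_sum b - block_sum fold b i.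
    rewrite /sign_sum; under eq_bigr do rewrite tnth_mktuple.
    rewrite -(big_enum_val (fun j => sgnb (tnth b j))).
    rewrite [in RHS](bigID (mem (fold_set fold i)))/= -block_sumE addrAC subrr add0r.
    by apply: eq_bigl => j; rewrite finset.in_setC.
  have sum1 := miss_sum1 bi bi0.
  set v := vote _ _; have voteE : missA bi false - missA bi true = v.
    by rewrite /v -Tbi -cardi; exact: sP.
  under eq_bigr => j _.
    rewrite tnth_mktuple (_ : miss _ _ _ _ = 2^-1 - (sgnb (tnth b j))%:~R * (v / 2)); last first.
      by case: (tnth b j); rewrite /sgnb /= ?rmorphN/=; lra.
    over.
  rewrite big_split/= sumr_const bal sumrN -mulr_suml -rmorph_sum/= -block_sumE.
  by rewrite -/m -mulr_natl; field; rewrite pnatr_eq0 -lt0n.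
under eq_bigr do rewrite foldE.
rewrite big_split/= sumr_const card_ord sumrN -mulr_sumr -/(correlation _ _ _).
have -> : n%:R = k%:R * m%:R :> R by rewrite -natrM -nkm.
by rewrite -mulr_natl; field; rewrite !pnatr_eq0 -!lt0n k0 m0.
Qed.

End majority.

Theorem mainTheorem5 (R : realType) (dX dY dH : measure_display)
    (X : measurableType dX) (Y : measurableType dY) (H : measurableType dH)
    (ev : H -> X -> Y) (ev_inj : injective ev)
    (ev_meas : measurable_error ev)
    (H_ge2 : exists h1 h2 : H, h1 <> h2)
    (A : forall n, n.-tuple (X * Y) -> probability H R)
    (A_meas : measurable_rule A)
    (A_perm : permutation_invariant A)
    (A_ERM : is_ERM ev A) :
  exists2 c : R, 0 < c & exists n0 : nat, forall n k : nat,
    (n0 <= n)%N -> (2 <= k)%N -> (k %| n)%N ->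
    forall fold : 'I_n -> 'I_k, balanced fold ->
    ((c * (Num.sqrt k%:R / n%:R))%:E <=
     ereal_sup [set cv_mse ev A fold D
               | D in [set: probability (X * Y)%type R]])%E.
Proof.
have [h1 [h2 h12]] := H_ge2.
have [x0 x0P] : exists x0, ev h1 x0 <> ev h2 x0.
  apply: contrapT => none; apply: h12; apply: ev_inj; apply/funext => x.
  by apply: contrapT => neq; apply: none; exists x.
pose hyp (c : bool) := if c then h1 else h2.
(* the 4 is the square of the 2 in the factor (2 n)^-1 of the gap *)
exists (4 * 4224)^-1; first by rewrite invr_gt0 mulr_gt0 ?ltr0n.
exists 1%N => n k n0 k2 kn fold bal.
have [s gapE] := mean_gap_correlation ev_meas A_perm A_ERM (hyp := hyp) x0P n0 k2 kn bal.
apply: le_trans (ereal_sup_ubound _); last first.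
  by exists (coin_prob R (atom ev x0 hyp)).
apply: le_trans (cv_mse_coin_ge ev_meas A_meas fold (atom ev x0 hyp)).
rewrite lee_fin.
under eq_coin_mean => b do rewrite -/(coin_sample ev x0 hyp b) gapE exprMn.
rewrite coin_meanZ sqrrN exprVn.
have n0' : 0 < n%:R :> R by rewrite ltr0n.
have -> : (4 * 4224)^-1 * (Num.sqrt k%:R / n%:R) =
    ((2 * n%:R) ^+ 2)^-1 * (n%:R * Num.sqrt k%:R / 4224) :> R.
  by field; rewrite gt_eqF.
rewrite ler_pM2l ?invr_gt0 ?exprn_gt0 ?mulr_gt0//.
exact: correlation_sqr_ge.
Qed.
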